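(* Let $N=2M$ and let $\{\Sigma_a\}_{a=1}^{d}$, with $d=\tfrac{N(N+1)}2-1$, be a basis of the space of traceless complex-symmetric $N\times N$ matrices that is orthonormal for the bilinear trace form (no complex conjugation): $\mathrm{Tr}(\Sigma_a\Sigma_b)=\delta_{ab}$, $\mathrm{Tr}\,\Sigma_a=0$, $\Sigma_a^{T}=\Sigma_a$. (Such a basis exists.) Let $\rho_z$, $z\in\mathbb{C}$, be the pseudo-density of an initial law as defined in the context, and write $$\rho_z=\frac{\mathrm{Tr}\,\rho_z}{N}\,\mathrm{I}+\sum_{a=1}^{d}r_a(z)\,\Sigma_a,\qquad r_a(z)=\mathrm{Tr}(\rho_z\Sigma_a).$$ Then, with the dot denoting $d/dz$, the coordinate vector obeys the linear flow $$\dot r_a(z)=\sum_{b=1}^{d}\Omega_{ab}\,r_b(z),\qquad \Omega_{ab}=\mathrm{Tr}\bigl(\Sigma_a[K,\Sigma_b]\bigr),\qquad \Omega^{T}=-\Omega.$$ Hence the flow lies in $\mathrm{O}(d,\mathbb{C})$ and preserves the bilinear quantity $\sum_a r_a^{2}$.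
   Context: Let $M\ge 2$ and let $Q=(Q_{ij})_{1\le i,j\le M}$ be the generator of an irreducible continuous-time Markov chain: $Q_{ij}\ge0$ for $i\neq j$ and $Q_{ii}=-\sum_{j\ne i}Q_{ij}$. Let $\nu$ be its unique stationary probability vector (strictly positive, $Q^{T}\nu=0$), and assume reversibility (detailed balance): $\nu_iQ_{ij}=\nu_jQ_{ji}$ for all $i,j$. Fix $\Lambda>0$ with $\Lambda\ge\max_i(-Q_{ii})$ and set $P:=\mathrm{I}+\tfrac1\Lambda Q$, $D:=\mathrm{diag}(\sqrt{\nu_1},\dots,\sqrt{\nu_M})$, $A:=DPD^{-1}$ (real symmetric by reversibility). Let $K:=\begin{pmatrix}0&-iA\\ iA&0\end{pmatrix}\in\mathbb{C}^{2M\times 2M}$ and $W_z:=e^{zK}$. Let $\widehat D=\mathrm{diag}(D,D)$, $V=\mathrm{diag}(\mathrm{I}_M,i\,\mathrm{I}_M)$, $B:=V\widehat D^{-1}$. For an initial law $\pi_0$ (column vector) put $\widehat\pi_0:=\binom{\pi_0}{0}$, $\Phi_0:=B\widehat\pi_0$, $\Phi_z:=W_z\Phi_0$ (pseudo-wave) and $\rho_z:=\Phi_z\Phi_z^{T}$ (pseudo-density). The superscript $T$ is the plain transpose with no conjugation; $[X,Y]=XY-YX$; $\mathrm{O}(d,\mathbb{C})=\{R\in\mathbb{C}^{d\times d}:R^{T}R=\mathrm{I}\}$. *)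

(* Defs.v *)
From HB Require Import structures.
From mathcomp Require Import all_boot all_order all_algebra.
From mathcomp Require Import all_classical all_reals all_analysis.
From mathcomp Require Import complex.

Set Implicit Arguments.
Unset Strict Implicit.
Unset Printing Implicit Defensive.

Import Order.TTheory GRing.Theory Num.Theory numFieldNormedType.Exports.

Local Open Scope classical_set_scope.
Local Open Scope ring_scope.
Local Open Scope complex_scope.

Definition is_generator (R : realType) (M : nat) (Q : 'M[R]_M) : Prop :=
  (forall i j, i != j -> 0 <= Q i j) /\
  (forall i, Q i i = - \sum_(j < M | j != i) Q i j).

(* For a generator, 0 < Q i j forces i != j, so these are exactly the
   possible jumps of the chain. *)
Definition irreducible_generator (R : realType) (M : nat) (Q : 'M[R]_M) : Prop :=
  forall i j : 'I_M, connect (fun k l : 'I_M => 0 < Q k l) i j.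

Definition is_law (R : realType) (M : nat) (p : 'cV[R]_M) : Prop :=
  (forall i, 0 <= p i ord0) /\ \sum_(i < M) p i ord0 = 1.

(* Uniqueness is not recorded: it follows from irreducibility. *)
Definition is_stationary_law (R : realType) (M : nat)
    (Q : 'M[R]_M) (nu : 'cV[R]_M) : Prop :=
  [/\ is_law nu, forall i, 0 < nu i ord0 & Q^T *m nu = 0].

Definition detailed_balance (R : realType) (M : nat)
    (Q : 'M[R]_M) (nu : 'cV[R]_M) : Prop :=
  forall i j, nu i ord0 * Q i j = nu j ord0 * Q j i.

Definition uniformized (R : realType) (M : nat) (Q : 'M[R]_M) (Lam : R) : 'M[R]_M :=
  1%:M + Lam^-1 *: Q.

Definition Dmx (R : realType) (M : nat) (nu : 'cV[R]_M) : 'M[R]_M :=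
  diag_mx (\row_i Num.sqrt (nu i ord0)).

Definition Amx (R : realType) (M : nat) (Q : 'M[R]_M) (nu : 'cV[R]_M) (Lam : R) :
    'M[R]_M :=
  Dmx nu *m uniformized Q Lam *m invmx (Dmx nu).

Definition cplx_mx (R : realType) (m n : nat) (X : 'M[R]_(m, n)) : 'M[R[i]]_(m, n) :=
  map_mx (real_complex R) X.

Definition Kmx (R : realType) (M : nat) (Q : 'M[R]_M) (nu : 'cV[R]_M) (Lam : R) :
    'M[R[i]]_(M + M) :=
  block_mx 0 (- 'i%C *: cplx_mx (Amx Q nu Lam))
           ('i%C *: cplx_mx (Amx Q nu Lam)) 0.

Definition Dhat (R : realType) (M : nat) (nu : 'cV[R]_M) : 'M[R[i]]_(M + M) :=
  block_mx (cplx_mx (Dmx nu)) 0 0 (cplx_mx (Dmx nu)).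

Definition Vmx (R : realType) (M : nat) : 'M[R[i]]_(M + M) :=
  block_mx 1%:M 0 0 ('i%C)%:M.

Definition Bmx (R : realType) (M : nat) (nu : 'cV[R]_M) : 'M[R[i]]_(M + M) :=
  Vmx R M *m invmx (Dhat nu).

(* Matrix exponential: the limit of the partial sums of the exponential series,
   for the normed topology on complex matrices. *)
Definition expmx (R : realType) (n : nat) (X : 'M[R[i]]_n) : 'M[R[i]]_n :=
  limn (series (fun k : nat => (k`!%:R)^-1 *: X ^+ k)).

Definition pseudo_wave (R : realType) (M : nat) (Q : 'M[R]_M) (nu : 'cV[R]_M)
    (Lam : R) (pi0 : 'cV[R]_M) (z : R[i]) : 'cV[R[i]]_(M + M) :=
  expmx (z *: Kmx Q nu Lam) *m (Bmx nu *m col_mx (cplx_mx pi0) 0).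

Definition pseudo_density (R : realType) (M : nat) (Q : 'M[R]_M) (nu : 'cV[R]_M)
    (Lam : R) (pi0 : 'cV[R]_M) (z : R[i]) : 'M[R[i]]_(M + M) :=
  pseudo_wave Q nu Lam pi0 z *m (pseudo_wave Q nu Lam pi0 z)^T.

Definition mxcommutator (R : realType) (n : nat) (X Y : 'M[R[i]]_n) : 'M[R[i]]_n :=
  X *m Y - Y *m X.

Definition complex_orthogonal (R : realType) (n : nat) (X : 'M[R[i]]_n) : Prop :=
  X^T *m X = 1%:M.

Definition traceless_sym (R : realType) (n : nat) : {vspace 'M[R[i]]_n} :=
  (fixedSpace (linfun (fun X : 'M[R[i]]_n => X^T)) :&:
   lker (linfun (fun X : 'M[R[i]]_n => \tr X : R[i]^o)))%VS.

Lemma traceless_symP (R : realType) (n : nat) (X : 'M[R[i]]_n) :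
  reflect (X^T = X /\ \tr X = 0) (X \in traceless_sym R n).
Proof.
rewrite /traceless_sym memv_cap memv_ker.
apply: (iffP andP) => [[/fixedSpaceP + /eqP +]|[XT X0]].
  by rewrite !lfunE.
by split; [apply/fixedSpaceP; rewrite lfunE | rewrite lfunE; apply/eqP].
Qed.

Definition traceless_sym_dim (n : nat) : nat := ((n * n.+1) %/ 2 - 1)%N.

(* Orthonormality is for the bilinear trace form, without conjugation. *)
Definition orthonormal_basis (R : realType) (n d : nat)
    (S : 'I_d -> 'M[R[i]]_n) : Prop :=
  basis_of (traceless_sym R n) (codom S) /\
  (forall a b, \tr (S a *m S b) = (a == b)%:R).

Definition coords (R : realType) (n d : nat) (S : 'I_d -> 'M[R[i]]_n)
    (X : 'M[R[i]]_n) : 'cV[R[i]]_d :=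
  \col_a \tr (X *m S a).

Definition flow_gen (R : realType) (n d : nat) (S : 'I_d -> 'M[R[i]]_n)
    (K : 'M[R[i]]_n) : 'M[R[i]]_d :=
  \matrix_(a, b) \tr (S a *m mxcommutator K (S b)).

(* Main.v *)
Require Import Defs.
From HB Require Import structures.
From mathcomp Require Import all_boot all_order all_algebra.
From mathcomp Require Import all_classical all_reals all_analysis.
From mathcomp Require Import complex.
From mathcomp Require Import ring lra.

Set Implicit Arguments.
Unset Strict Implicit.
Unset Printing Implicit Defensive.

Import Order.TTheory GRing.Theory Num.Theory numFieldNormedType.Exports.

Local Open Scope classical_set_scope.
Local Open Scope ring_scope.
Local Open Scope complex_scope.

(** For a matrix [A] acting on the left and [B] on the right, the Sylvester
    operator [T : Y |-> A Y + Y B] is the sum of two commuting operators, so its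
    exponential is [X |-> exp(A) X exp(B)] (lemma [cvg_exp_sandwich]).  This
    single fact drives the proof.

    Detailed balance makes [Amx] symmetric, hence [Kmx] is antisymmetric for the
    plain transpose and the pseudo-density is the congruence
    [rho_z = exp(zK) rho_0 exp(zK)^T].  With [A = zK] and [B = (zK)^T = - zK] the
    Sylvester operator is [z [K, .]], which preserves symmetric matrices.  On
    those, a symmetric matrix being a scalar matrix plus its expansion on the
    orthonormal basis ([sym_expansion]), the commutator with [K] becomes, in
    coordinates, multiplication by [Omega] ([coords_commutator]): the scalar part
    commutes with [K].  Comparing the two exponential series term by term gives
    [r_z = exp(z Omega) r_0] ([coords_congruence]), from which everything else
    follows: the cyclicity of the trace makes [Omega] antisymmetric
    ([flow_gen_skew]), so [exp(z Omega)] is orthogonal and preserves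
    [sum_a r_a^2], and differentiating the exponential gives the linear flow.

    The analysis of the matrix exponential is reduced to that of the real
    exponential through the submultiplicative norm [mx_l1].  The Cauchy product
    of two matrix series differs from the partial sums of the Sylvester series by
    a remainder bounded, up to a constant, by the same remainder for real
    numbers, which tends to zero because [exp(a) exp(b) = exp(a + b)].  The
    complex derivative is obtained from a quadratic Taylor bound
    ([mx_l1_exp_taylor], [is_derive_quadratic]).

    For the existence of an orthonormal basis, index by the pairs [i <= j] other
    than [(0, 0)].  Off the diagonal take the normalized symmetric matrix units;
    on the diagonal, a reflection sends the vector [(1, ..., 1)] to a multiple of
    the first basis vector, and the images of the other basis vectors form an
    orthonormal basis of the vectors of sum zero ([sym_unit]).  Completeness is a
    dimension bound: a traceless symmetric matrix is determined by its entries at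
    these pairs. *)

Import Normc.

(** * Convergence of complex matrices *)

Lemma cvgn_sum (K : numFieldType) (V : normedModType K) (I : Type) (r : seq I)
    (f : I -> nat -> V) (l : I -> V) :
  (forall i, f i @ \oo --> l i) ->
  (fun k => \sum_(i <- r) f i k) @ \oo --> \sum_(i <- r) l i.
Proof.
move=> fl; elim: r => [|i r IH].
  by under eq_fun do rewrite big_nil; rewrite big_nil; exact: cvg_cst.
under eq_fun do rewrite big_cons; rewrite big_cons; exact: cvgD.
Qed.

Section EntrywiseNorm.
Variable R : realType.
Local Notation C := R[i].
(* The cast to [C^o] selects the normed topology on complex matrices. *)
Local Notation "u ~~> l" := (u @ \oo --> (l : 'M[C^o]_(_, _))) (at level 70).

(** The sum of the moduli of the entries, valued in the reals so that matrix
    series can be compared with real ones; it is submultiplicative for all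
    sizes. *)
Definition mx_l1 m n (X : 'M[C]_(m, n)) : R := \sum_i \sum_j normc (X i j).

Lemma normc_ge0 (x : C) : 0 <= normc x.
Proof. by rewrite -ler0c; exact: (@normr_ge0 C C). Qed.

Lemma mx_l1_ge0 m n (X : 'M[C]_(m, n)) : 0 <= mx_l1 X.
Proof. by do 2![apply: sumr_ge0 => ? _]; exact: normc_ge0. Qed.

Lemma normc_le_mx_l1 m n (X : 'M[C]_(m, n)) i j : normc (X i j) <= mx_l1 X.
Proof.
rewrite /mx_l1 (bigD1 i)//= (bigD1 j)//= -addrA lerDl addr_ge0//.
  by apply: sumr_ge0 => ? _; exact: normc_ge0.
by do 2![apply: sumr_ge0 => ? _]; exact: normc_ge0.
Qed.

Lemma mx_l1_0 m n : mx_l1 (0 : 'M[C]_(m, n)) = 0.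
Proof. by apply: big1 => i _; apply: big1 => j _; rewrite mxE normc0. Qed.

Lemma mx_l1D m n (X Y : 'M[C]_(m, n)) : mx_l1 (X + Y) <= mx_l1 X + mx_l1 Y.
Proof.
rewrite /mx_l1 -big_split; apply: ler_sum => i _.
rewrite -big_split; apply: ler_sum => j _; rewrite mxE; exact: le_normcD.
Qed.

Lemma mx_l1N m n (X : 'M[C]_(m, n)) : mx_l1 (- X) = mx_l1 X.
Proof.
by apply: eq_bigr => i _; apply: eq_bigr => j _; rewrite mxE; exact: normcN.
Qed.

Lemma mx_l1Z m n (a : C) (X : 'M[C]_(m, n)) :
  mx_l1 (a *: X) = normc a * mx_l1 X.
Proof.
rewrite /mx_l1 mulr_sumr; apply: eq_bigr => i _.
by rewrite mulr_sumr; apply: eq_bigr => j _; rewrite mxE normcM.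
Qed.

Lemma mx_l1_sum m n (I : Type) (r : seq I) (P : pred I) (F : I -> 'M[C]_(m, n)) :
  mx_l1 (\sum_(k <- r | P k) F k) <= \sum_(k <- r | P k) mx_l1 (F k).
Proof.
elim/big_ind2: _ => [|X a Y b hX hY|//]; first by rewrite mx_l1_0.
by apply: le_trans (mx_l1D _ _) _; rewrite lerD.
Qed.

Lemma normc_sum (I : Type) (r : seq I) (P : pred I) (F : I -> C) :
  normc (\sum_(k <- r | P k) F k) <= \sum_(k <- r | P k) normc (F k).
Proof.
elim/big_ind2: _ => [|x a y b hx hy|//]; first by rewrite normc0.
by apply: le_trans (le_normcD _ _) _; rewrite lerD.
Qed.

Lemma mx_l1M m n p (X : 'M[C]_(m, n)) (Y : 'M[C]_(n, p)) :
  mx_l1 (X *m Y) <= mx_l1 X * mx_l1 Y.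
Proof.
rewrite /mx_l1 mulr_suml; apply: ler_sum => i _.
apply: (@le_trans _ _ (\sum_k \sum_j normc (X i j) * normc (Y j k))).
  apply: ler_sum => k _; rewrite mxE; apply: le_trans (normc_sum _ _ _) _.
  by apply: ler_sum => j _; rewrite normcM.
rewrite exchange_big mulr_suml; apply: ler_sum => j _.
rewrite -mulr_sumr ler_wpM2l ?normc_ge0//= (bigD1 j)//= lerDl.
by do 2![apply: sumr_ge0 => ? _]; exact: normc_ge0.
Qed.

Lemma normc_nat n : normc (n%:R : C) = n%:R.
Proof. by rewrite normcMn normc1. Qed.

Lemma cvg_entries m n (u : nat -> 'M[C]_(m, n)) (l : 'M[C]_(m, n)) :
  (forall i j, (fun k => u k i j) @ \oo --> (l i j : C^o)) -> u ~~> l.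
Proof.
move=> ul A [P Pl PA].
have : \forall k \near \oo, forall ij : 'I_m * 'I_n, P ij.1 ij.2 (u k ij.1 ij.2).
  by apply: filter_forall => -[i j] /=; apply: ul; exact: Pl.
by apply: filterS => k Pk; apply: PA => i j; exact: (Pk (i, j)).
Qed.

Lemma cvg_entry m n (u : nat -> 'M[C]_(m, n)) (l : 'M[C]_(m, n)) i j :
  u ~~> l -> (fun k => u k i j) @ \oo --> (l i j : C^o).
Proof.
by move=> ul; apply: (cvg_comp u (fun X : 'M[C]_(m, n) => X i j) ul);
   exact: coord_continuous.
Qed.

Lemma cvg_normc (u : nat -> C) (l : C) :
  (fun k => normc (u k - l)) @ \oo --> (0 : R) -> u @ \oo --> (l : C^o).
Proof.
move=> ul; apply/(@cvgrPdist_lt _ C^o) => e e0.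
have [eIm eRe] : complex.Im e = 0 /\ 0 < complex.Re e.
  by move: e0; rewrite ltcE /= => /andP[/eqP -> ->].
have /cvgrPdist_lt/(_ _ eRe) := ul.
apply: filterS => k; rewrite sub0r normrN ger0_norm ?normc_ge0// => h.
rewrite distrC.
suff -> : e = (complex.Re e)%:C by rewrite -[X in X < _]/((normc _)%:C) ltcR.
by apply/eqP; rewrite eq_complex /= eIm !eqxx.
Qed.

Lemma cvg_normc0 (u : nat -> C) (l : C) :
  u @ \oo --> (l : C^o) -> (fun k => normc (u k - l)) @ \oo --> (0 : R).
Proof.
move=> ul; apply/cvgrPdist_lt => e e0.
have e0C : 0 < e%:C by rewrite (ltcR 0 e).
have /(@cvgrPdist_lt _ C^o)/(_ _ e0C) := ul.
apply: filterS => k h; rewrite sub0r normrN ger0_norm ?normc_ge0//.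
by move: h; rewrite distrC -[X in X < _]/((normc _)%:C) ltcR.
Qed.

Lemma cvg_mx_l1 m n (u : nat -> 'M[C]_(m, n)) (l : 'M[C]_(m, n)) :
  (fun k => mx_l1 (u k - l)) @ \oo --> (0 : R) -> u ~~> l.
Proof.
move=> ul; apply: cvg_entries => i j; apply: cvg_normc.
apply: squeeze_cvgr (cvg_cst 0) ul; near=> k.
rewrite normc_ge0 /=; have := normc_le_mx_l1 (u k - l) i j.
by rewrite !mxE.
Unshelve. all: by end_near. Qed.

Lemma cvg_mx_l1_0 m n (u : nat -> 'M[C]_(m, n)) (l : 'M[C]_(m, n)) :
  u ~~> l -> (fun k => mx_l1 (u k - l)) @ \oo --> (0 : R).
Proof.
move=> ul; rewrite /mx_l1.
have z : \sum_(i < m) \sum_(j < n) 0 = 0 :> R.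
  by rewrite big1 // => ? _; rewrite big1.
rewrite -[X in _ --> X]z.
apply: (@cvgn_sum _ R^o) => i; apply: (@cvgn_sum _ R^o) => j.
under eq_fun do rewrite !mxE.
exact/cvg_normc0/cvg_entry.
Qed.

Lemma cvg_mx_unique m n (u : nat -> 'M[C]_(m, n)) (l l' : 'M[C]_(m, n)) :
  u ~~> l -> u ~~> l' -> l = l'.
Proof.
have hd : hausdorff_space 'M[C^o]_(m, n) by exact: norm_hausdorff.
move=> ul ul'; exact: (cvg_unique hd ul ul').
Qed.

(** Balls for [mx_l1] are closed, so that bounds on partial sums pass to the
    sum of a series. *)
Lemma mx_l1_lim_le m n (u : nat -> 'M[C]_(m, n)) (l a : 'M[C]_(m, n)) (c : R) :
  u ~~> l -> (\forall k \near \oo, mx_l1 (u k - a) <= c) ->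
  mx_l1 (l - a) <= c.
Proof.
move=> /cvg_mx_l1_0 ul uc; apply/ler_addgt0Pr => e e0.
have /cvgrPdist_lt/(_ _ e0) ue := ul.
have [k [/= h1 h2]] : exists k,
    `|0 - mx_l1 (u k - l)| < e /\ mx_l1 (u k - a) <= c.
  exact: (filter_ex (filterI ue uc)).
move: h1; rewrite sub0r normrN ger0_norm ?mx_l1_ge0// => h1.
have -> : l - a = (u k - a) + - (u k - l) by rewrite opprB [RHS]addrC addrA subrK.
by apply: le_trans (mx_l1D _ _) _; rewrite mx_l1N lerD// ltW.
Qed.

Lemma cvg_mulmx m n p (u : nat -> 'M[C]_(m, n)) (v : nat -> 'M[C]_(n, p)) X Y :
  u ~~> X -> v ~~> Y -> (fun k => u k *m v k) ~~> X *m Y.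
Proof.
move=> uX vY; apply: cvg_entries => i j; rewrite mxE.
under eq_fun do rewrite mxE.
apply: (@cvgn_sum _ C^o) => k.
by apply: cvgM; exact: cvg_entry.
Qed.

End EntrywiseNorm.

(** * Absolutely convergent series and the exponential *)

Section Exponential.
Variable R : realType.
Local Notation C := R[i].
Local Notation "u ~~> l" := (u @ \oo --> (l : 'M[C^o]_(_, _))) (at level 70).

Lemma normc_le_ReDIm (x : C) :
  normc x <= `|complex.Re x| + `|complex.Im x|.
Proof.
case: x => a b /=.
rewrite -[leRHS]ger0_norm ?addr_ge0// -sqrtr_sqr ler_sqrt ?sqr_ge0//.
rewrite -[a ^+ 2]real_normK ?num_real// -[b ^+ 2]real_normK ?num_real//.
by rewrite sqrrD; have := mulr_ge0 (normr_ge0 a) (normr_ge0 b); lra.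
Qed.

Lemma Re_le_normc (x : C) : `|complex.Re x| <= normc x.
Proof.
case: x => a b /=; rewrite -sqrtr_sqr ler_sqrt ?addr_ge0 ?sqr_ge0//.
by rewrite lerDl sqr_ge0.
Qed.

Lemma Im_le_normc (x : C) : `|complex.Im x| <= normc x.
Proof.
case: x => a b /=; rewrite -sqrtr_sqr ler_sqrt ?addr_ge0 ?sqr_ge0//.
by rewrite lerDr sqr_ge0.
Qed.

Lemma cvg_ReIm (u : nat -> C) (a b : R) :
  (fun k => complex.Re (u k)) @ \oo --> a ->
  (fun k => complex.Im (u k)) @ \oo --> b -> u @ \oo --> (a +i* b : C^o).
Proof.
move=> ua ub; apply: cvg_normc.
have h : (fun k => `|complex.Re (u k) - a| + `|complex.Im (u k) - b|) @ \oo
    --> `|a - a| + `|b - b|.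
  by apply: cvgD; apply: (@cvg_norm _ R^o); apply: cvgB => //; exact: cvg_cst.
rewrite !subrr normr0 addr0 in h.
apply: squeeze_cvgr (cvg_cst 0) h; near=> k.
rewrite normc_ge0 /=; apply: le_trans (normc_le_ReDIm _) _.
by case: (u k).
Unshelve. all: by end_near. Qed.

Lemma ReE_sum (I : Type) (r : seq I) (F : I -> C) :
  complex.Re (\sum_(i <- r) F i) = \sum_(i <- r) complex.Re (F i).
Proof. by elim/big_rec2: _ => // i x y _ <-; case: (F i) y => ? ? [? ?]. Qed.

Lemma ImE_sum (I : Type) (r : seq I) (F : I -> C) :
  complex.Im (\sum_(i <- r) F i) = \sum_(i <- r) complex.Im (F i).
Proof. by elim/big_rec2: _ => // i x y _ <-; case: (F i) y => ? ? [? ?]. Qed.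

(** Comparison test: the entries are handled through their real and imaginary
    parts, for which absolute convergence is available. *)
Lemma is_cvg_mx_series m n (u : nat -> 'M[C]_(m, n)) (c : nat -> R) :
  (forall k, mx_l1 (u k) <= c k) -> cvgn (series c) ->
  exists l, series u ~~> l.
Proof.
move=> uc cc.
have c0 k : 0 <= c k := le_trans (mx_l1_ge0 _) (uc k).
have cvg_coef (f : C -> R) i j : (forall x, `|f x| <= normc x) ->
    cvgn (series (fun k => f (u k i j))).
  move=> fn; apply: (@normed_cvg _ R^o).
  apply: series_le_cvg (c0) _ cc => k //=.
  apply: le_trans (fn _) _; apply: le_trans (uc k); exact: normc_le_mx_l1.
exists (\matrix_(i, j) (limn (series (fun k => complex.Re (u k i j))) +i*
                        limn (series (fun k => complex.Im (u k i j))))).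
apply: cvg_entries => i j; rewrite mxE; apply: cvg_ReIm.
  have := cvg_coef _ i j Re_le_normc.
  by rewrite /series /=; under [X in _ -> X @ _ --> _]eq_fun
    do rewrite summxE ReE_sum.
have := cvg_coef _ i j Im_le_normc.
by rewrite /series /=; under [X in _ -> X @ _ --> _]eq_fun
  do rewrite summxE ImE_sum.
Qed.

(** The factor [X] absorbs the case [k = 0], in which [mx_l1 1%:M] is the size of
    the matrix and not [1]. *)
Lemma mx_l1_expM m n (A : 'M[C]_m) (X : 'M[C]_(m, n)) k :
  mx_l1 (A ^+ k *m X) <= mx_l1 A ^+ k * mx_l1 X.
Proof.
elim: k => [|k IH]; first by rewrite !expr0 mul1mx mul1r.
rewrite !exprS -mulmxE -mulmxA -mulrA; apply: le_trans (mx_l1M _ _) _.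
by rewrite ler_wpM2l ?mx_l1_ge0.
Qed.

Lemma mx_l1_Mexp m n (X : 'M[C]_(m, n)) (B : 'M[C]_n) k :
  mx_l1 (X *m B ^+ k) <= mx_l1 X * mx_l1 B ^+ k.
Proof.
elim: k => [|k IH]; first by rewrite !expr0 mulmx1 mulr1.
rewrite !exprSr -mulmxE mulmxA mulrA; apply: le_trans (mx_l1M _ _) _.
by rewrite ler_wpM2r ?mx_l1_ge0.
Qed.

Lemma normc_invfact k : normc ((k`!%:R)^-1 : C) = (k`!%:R)^-1.
Proof. by rewrite normcV normc_nat. Qed.

(** The limit defining [expmx] exists: its terms are dominated by those of the
    exponential series of [mx_l1 X]. *)
Lemma cvg_expmx n (X : 'M[C]_n) :
  series (fun k => (k`!%:R)^-1 *: X ^+ k) ~~> expmx X.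
Proof.
have [||l sl] := @is_cvg_mx_series n n (fun k => (k`!%:R)^-1 *: X ^+ k)
    (mx_l1 (1%:M : 'M[C]_n) *: exp_coeff (mx_l1 X)).
- move=> k; rewrite mx_l1Z normc_invfact -[X ^+ k]mulmx1.
  rewrite -[leRHS]/(mx_l1 (1%:M : 'M[C]_n) * (mx_l1 X ^+ k / k`!%:R)).
  rewrite mulrC mulrA ler_wpM2r ?invr_ge0// mulrC.
  exact: mx_l1_expM.
- exact/is_cvg_seriesZ/is_cvg_series_exp_coeff.
have hd : hausdorff_space 'M[C^o]_n by exact: norm_hausdorff.
suff -> : expmx X = l by [].
exact: (cvg_lim hd sl).
Qed.

(** The square of indices below [n] splits into its antidiagonals [i + j = k < n]
    and a corner.  The first part is the partial sum of a Cauchy product, the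
    second the remainder; the lemma serves both matrices and reals. *)
Lemma sum_square_triangle (V : nmodType) (f : nat -> nat -> V) n :
  \sum_(i < n) \sum_(j < n) f i j =
  \sum_(k < n) \sum_(i < k.+1) f i (k - i)%N
  + \sum_(i < n) \sum_(j < n | (n <= i + j)%N) f i j.
Proof.
transitivity (\sum_(i < n) (\sum_(k < n | (i <= k)%N) f i (k - i)%N
                           + \sum_(j < n | (n <= i + j)%N) f i j)).
  apply: eq_bigr => i _.
  rewrite (bigID (fun j : 'I_n => n <= i + j)%N) addrC; congr (_ + _).
  rewrite -(big_mkord (fun j => ~~ (n <= i + j)%N) (f i)).
  rewrite -(big_mkord (fun k => (i <= k)%N) (fun k => f i (k - i)%N)).
  transitivity (\sum_(0 <= j < n - i) f i j).
    rewrite [RHS](big_nat_widen _ _ n) ?leq_subr//.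
    by apply: eq_big => // j; rewrite -ltnNge ltn_subRL.
  rewrite (big_cat_nat (leq0n i) (ltnW (ltn_ord i)))/=.
  rewrite [X in _ = X + _]big_nat_cond [X in _ = X + _]big1 ?add0r; last first.
    by move=> k /andP[/andP[_ ki]]; rewrite leqNgt ki.
  rewrite -[X in _ = \sum_(X <= _ < _ | _) _]add0n [RHS]big_addn.
  by apply: eq_big => k; rewrite ?addnK ?leq_addl.
rewrite big_split; congr (_ + _) => /=.
rewrite (exchange_big_dep xpredT)//=; apply: eq_bigr => k _.
by rewrite (big_ord_widen n (fun i => f i (k - i)%N) (ltn_ord k)).
Qed.

End Exponential.
Arguments cvg_expmx {R n} X.

(** * The exponential of a Sylvester operator *)

Section Sandwich.
Variable R : realType.
Local Notation C := R[i].
Local Notation "u ~~> l" := (u @ \oo --> (l : 'M[C^o]_(_, _))) (at level 70).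

Definition sylvester m n (A : 'M[C]_m) (B : 'M[C]_n) (Y : 'M[C]_(m, n)) :=
  A *m Y + Y *m B.

(** Binomial theorem: left multiplication by [A] and right multiplication by [B]
    commute. *)
Lemma iter_sylvester m n (A : 'M[C]_m) (B : 'M[C]_n) (X : 'M[C]_(m, n)) k :
  iter k (sylvester A B) X =
  \sum_(i < k.+1) (A ^+ (k - i) *m X *m B ^+ i) *+ 'C(k, i).
Proof.
elim: k => [|k IHk]; first by rewrite big_ord1 /= !expr0 mul1mx mulmx1 bin0.
rewrite iterS {}IHk /sylvester mulmx_sumr mulmx_suml.
rewrite [RHS]big_ord_recl [X in _ = _ + X]big_ord_recr /=.
rewrite [X in X + _ = _]big_ord_recl [X in _ + X = _]big_ord_recr /=.
rewrite !subn0 !bin0 !mulr1n !mulmxA !mulmxE -exprS -!addrA; congr (_ + _).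
rewrite addrA -big_split /=; congr (_ + _).
  apply: eq_bigr => i _; rewrite /bump leq0n add1n linearMn /=.
  rewrite -[X in _ + X = _]/(mulmxr B _) linearMn /=.
  rewrite !mulmxA !mulmxE -exprS -subSn ?(valP i)// subSS.
  by rewrite -[_ *m B]mulmxA mulmxE -exprSr -mulrnDr -binS.
rewrite /bump leq0n add1n !subnn !binn !mulr1n !expr0 mul1mx.
by rewrite -[_ *m B]mulmxA mulmxE -exprSr.
Qed.

Lemma fact_binV k i : (i <= k)%N ->
  (k`!%:R)^-1 *+ 'C(k, i) = (i`!%:R)^-1 * ((k - i)`!%:R)^-1 :> C.
Proof.
move=> ik; have f0 j : (j`!%:R : C) != 0 by rewrite pnatr_eq0 -lt0n fact_gt0.
have c0 : ('C(k, i)%:R : C) != 0 by rewrite pnatr_eq0 -lt0n bin_gt0.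
rewrite -mulr_natr -(bin_fact ik) !natrM; field.
by rewrite c0 !f0.
Qed.

(** Divided by [k!], the binomial expansion is the [k]-th antidiagonal of the
    product of the two exponential series. *)
Lemma iter_sylvester_div_fact m n (A : 'M[C]_m) (B : 'M[C]_n)
    (X : 'M[C]_(m, n)) k :
  (k`!%:R)^-1 *: iter k (sylvester A B) X =
  \sum_(i < k.+1) ((k - i)`!%:R^-1 *: A ^+ (k - i)) *m X
                     *m (i`!%:R^-1 *: B ^+ i).
Proof.
rewrite iter_sylvester scaler_sumr; apply: eq_bigr => i _.
rewrite -scalerMnr scalerMnl fact_binV; last by rewrite -ltnS.
by rewrite -!scalemxAl -scalemxAr !scalerA mulrC.
Qed.

Lemma sum_exp_coeffD (a b : R) k :
  \sum_(i < k.+1) exp_coeff b i * exp_coeff a (k - i)%N = exp_coeff (a + b) k.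
Proof.
rewrite /exp_coeff /= exprDn mulr_suml; apply: eq_bigr => i _.
have ik : (i <= k)%N by rewrite -ltnS.
have f0 j : (j`!%:R : R) != 0 by rewrite pnatr_eq0 -lt0n fact_gt0.
have c0 : ('C(k, i)%:R : R) != 0 by rewrite pnatr_eq0 -lt0n bin_gt0.
rewrite -mulr_natr -(bin_fact ik) !natrM; field.
by rewrite c0 !f0.
Qed.

(** The corner of the square is the product of two partial sums minus a partial
    sum of the exponential series at [a + b], and [expR] is a morphism. *)
Lemma cvg_exp_square_remainder (a b : R) :
  (fun n => \sum_(i < n) \sum_(j < n | (n <= i + j)%N)
     exp_coeff b i * exp_coeff a j) @ \oo --> (0 : R).
Proof.
have s_cvg (x : R) : series (exp_coeff x) @ \oo --> expR x.
  exact: is_cvg_series_exp_coeff.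
have : (fun n => series (exp_coeff b) n * series (exp_coeff a) n
                 - series (exp_coeff (a + b)) n) @ \oo --> (0 : R).
  have <- : expR b * expR a - expR (a + b) = 0.
    by rewrite expRD mulrC subrr.
  apply: cvgB (s_cvg _).
  by apply: cvgM; exact: s_cvg.
suff -> : (fun n => series (exp_coeff b) n * series (exp_coeff a) n
                 - series (exp_coeff (a + b)) n) =
    fun n => \sum_(i < n) \sum_(j < n | (n <= i + j)%N)
                exp_coeff b i * exp_coeff a j by [].
apply/funext => n; rewrite /series /= !big_mkord mulr_suml.
under [X in X - _]eq_bigr do rewrite mulr_sumr.
rewrite (sum_square_triangle (fun i j => exp_coeff b i * exp_coeff a j)).
under [X in X + _ - _]eq_bigr do rewrite sum_exp_coeffD.
by rewrite addrAC subrr add0r.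
Qed.

(** The exponential of the Sylvester operator.  The product of the partial sums
    of [expmx A] and [expmx B] tends to the right-hand side, and its distance to
    the partial sum on the left is at most [mx_l1 X] times the real remainder of
    [cvg_exp_square_remainder]. *)
Lemma cvg_exp_sandwich m n (A : 'M[C]_m) (X : 'M[C]_(m, n)) (B : 'M[C]_n) :
  series (fun k => (k`!%:R)^-1 *: iter k (sylvester A B) X)
    ~~> expmx A *m X *m expmx B.
Proof.
pose sA n := series (fun k => (k`!%:R)^-1 *: A ^+ k) n.
pose sB n := series (fun k => (k`!%:R)^-1 *: B ^+ k) n.
have sAXB : (fun n => sA n *m X *m sB n) ~~> expmx A *m X *m expmx B.
  have AX : (fun n => sA n *m X) ~~> expmx A *m X.
    have XX : (fun _ : nat => X) ~~> X by exact: (@cvg_cst 'M[C^o]_(m, n)).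
    exact: cvg_mulmx (cvg_expmx A) XX.
  exact: cvg_mulmx AX (cvg_expmx B).
apply: cvg_mx_l1; set L := _ *m _.
pose e n := \sum_(i < n) \sum_(j < n | (n <= i + j)%N)
  exp_coeff (mx_l1 B) i * exp_coeff (mx_l1 A) j.
have h : (fun n => mx_l1 (sA n *m X *m sB n - L) + mx_l1 X * e n) @ \oo
    --> (0 : R).
  have <- : 0 + mx_l1 X * 0 = 0 :> R by rewrite mulr0 addr0.
  apply: cvgD; first exact: cvg_mx_l1_0.
  by apply: cvgM; [exact: cvg_cst | exact: cvg_exp_square_remainder].
apply: squeeze_cvgr (cvg_cst 0) h; near=> N; rewrite mx_l1_ge0 /=.
set S := series _ N; set s := _ * _.
suff eS : mx_l1 (sA N *m X *m sB N - S) <= s.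
  have -> : S - L = (sA N *m X *m sB N - L) + - (sA N *m X *m sB N - S).
    by rewrite opprB [RHS]addrC addrA subrK.
  by apply: le_trans (mx_l1D _ _) _; rewrite mx_l1N lerD2l.
pose f i j := ((j`!%:R)^-1 *: A ^+ j) *m X *m ((i`!%:R)^-1 *: B ^+ i).
have -> : sA N *m X *m sB N - S =
    \sum_(i < N) \sum_(j < N | (N <= i + j)%N) f i j.
  have := sum_square_triangle f N.
  under [X in _ = X + _]eq_bigr do rewrite /f -iter_sylvester_div_fact.
  rewrite /S /sA /sB /series /= !big_mkord !mulmx_suml.
  under [X in _ -> X - _ = _]eq_bigr do rewrite mulmx_sumr.
  by rewrite exchange_big => ->; rewrite addrAC subrr add0r.
apply: le_trans (mx_l1_sum _ _ _) _; rewrite /s mulr_sumr; apply: ler_sum => i _.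
apply: le_trans (mx_l1_sum _ _ _) _; rewrite mulr_sumr; apply: ler_sum => j _.
rewrite /f -!scalemxAl -!scalemxAr scalerA mx_l1Z normcM !normc_invfact.
have -> : mx_l1 X * (exp_coeff (mx_l1 B) i * exp_coeff (mx_l1 A) j) =
  (j`!%:R)^-1 / i`!%:R * (mx_l1 A ^+ j * mx_l1 X * mx_l1 B ^+ i).
  by rewrite /exp_coeff /=; ring.
rewrite ler_wpM2l ?mulr_ge0 ?invr_ge0//.
apply: le_trans (mx_l1_Mexp _ _ _) _.
by rewrite ler_wpM2r ?exprn_ge0 ?mx_l1_ge0 ?mx_l1_expM.
Unshelve. all: by end_near. Qed.

Lemma series_first_term m n (X : 'M[C]_(m, n)) (u : nat -> 'M[C]_(m, n)) :
  u 0%N = X -> (forall k, u k.+1 = 0) -> series u ~~> X.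
Proof.
move=> u0 uS; apply: cvg_mx_l1.
rewrite -(cvg_shiftS (fun k => mx_l1 (series u k - X))).
under eq_fun => k.
  rewrite /series /= big_mkord big_ord_recl u0 big1 => [|i _].
    rewrite addr0 subrr mx_l1_0.
  over.
  exact: uS.
exact: cvg_cst.
Qed.

Lemma expmx0 n : expmx (0 : 'M[C]_n) = 1%:M.
Proof.
apply: cvg_mx_unique (cvg_expmx 0) _; apply: series_first_term => [|k].
  by rewrite fact0 invr1 scale1r expr0.
by rewrite expr0n scaler0.
Qed.

Lemma iter_sylvester_comm n (A B : 'M[C]_n) k :
  A *m B = B *m A -> iter k (sylvester A B) 1%:M = (A + B) ^+ k.
Proof.
move=> AB; elim: k => [|k IHk]; first by rewrite expr0.
rewrite iterS IHk /sylvester !mulmxE exprS mulrDl; congr (_ + _).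
have : GRing.comm B (A + B) by rewrite /GRing.comm mulrDl mulrDr -!mulmxE AB.
by move/(commrX k).
Qed.

(** The Sylvester operator of commuting [A] and [B] maps [(A + B)^k] to
    [(A + B)^(k + 1)], so this is [cvg_exp_sandwich] around the identity. *)
Lemma expmxD n (A B : 'M[C]_n) :
  A *m B = B *m A -> expmx (A + B) = expmx A *m expmx B.
Proof.
move=> AB; apply: cvg_mx_unique (cvg_expmx (A + B)) _.
have := cvg_exp_sandwich (A := A) (X := 1%:M) (B := B); rewrite mulmx1.
by under eq_fun do rewrite iter_sylvester_comm//.
Qed.

Lemma expmxN n (A : 'M[C]_n) : expmx (- A) *m expmx A = 1%:M.
Proof. by rewrite -expmxD ?addNr ?expmx0// mulNmx mulmxN. Qed.

Lemma trmx_exp n (A : 'M[C]_n) k : (A ^+ k)^T = A^T ^+ k.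
Proof.
elim: k => [|k IHk]; first by rewrite !expr0 trmx1.
by rewrite exprS exprSr -!mulmxE trmx_mul IHk.
Qed.

Lemma scalemx_exp n (a : C) (A : 'M[C]_n) k : (a *: A) ^+ k = a ^+ k *: A ^+ k.
Proof.
elim: k => [|k IHk]; first by rewrite !expr0 scale1r.
by rewrite !exprS IHk -!mulmxE -scalemxAl -scalemxAr scalerA.
Qed.

Lemma expmx_tr n (A : 'M[C]_n) : (expmx A)^T = expmx A^T.
Proof.
apply: cvg_mx_unique (cvg_expmx A^T); apply: cvg_entries => i j; rewrite mxE.
have := cvg_entry (i := j) (j := i) (cvg_expmx A).
apply: cvg_trans; apply: near_eq_cvg; near=> k.
rewrite /series /= !summxE; apply: eq_bigr => l _.
by rewrite !mxE -trmx_exp mxE.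
Unshelve. all: by end_near. Qed.

(** For [|h| <= 1] every power of [h] occurring beyond the linear term is bounded
    by [|h|^2], and what remains is a partial sum of a real exponential. *)
Lemma mx_l1_exp_taylor n (X : 'M[C]_n) (h : C) : normc h <= 1 ->
  mx_l1 (expmx (h *: X) - (1%:M + h *: X)) <=
  mx_l1 (1%:M : 'M[C]_n) * expR (mx_l1 X) * normc h ^+ 2.
Proof.
move=> h1; apply: mx_l1_lim_le (cvg_expmx (h *: X)) _.
exists 2%N => // -[//|[//|k]] _ /=.
set x := mx_l1 X; set c := mx_l1 1%:M.
rewrite /series /= big_mkord 2!big_ord_recl /= fact0 expr0 expr1 invr1 !scale1r.
rewrite addrA [_ + \sum_(i < k) _]addrC -[1%:M]/(1 : 'M[C]_n) addrK.
apply: le_trans (mx_l1_sum _ _ _) _.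
apply: (@le_trans _ _ (c * normc h ^+ 2 * \sum_(i < k) exp_coeff x i.+2)).
  rewrite mulr_sumr; apply: ler_sum => i _.
  rewrite /bump !leq0n !add1n mx_l1Z normc_invfact scalemx_exp mx_l1Z.
  have -> : normc (h ^+ i.+2) = normc h ^+ i * normc h ^+ 2.
    rewrite -exprD addn2; elim: i.+2 => [|p IH]; first by rewrite !expr0 normc1.
    by rewrite !exprS normcM IH.
  have hX : mx_l1 (X ^+ i.+2) <= x ^+ i.+2 * c.
    by rewrite -[X ^+ _]mulmx1; exact: mx_l1_expM.
  rewrite [leRHS](_ : _ = (i.+2)`!%:R^-1 * (normc h ^+ 2 * (x ^+ i.+2 * c))).
    rewrite ler_wpM2l ?invr_ge0// -[leLHS]mulrA.
    apply: le_trans (ler_piMl _ _) _.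
    - by rewrite mulr_ge0 ?mx_l1_ge0// exprn_ge0 ?normc_ge0.
    - by rewrite exprn_ile1 ?normc_ge0.
    - by rewrite ler_wpM2l// exprn_ge0 ?normc_ge0.
  by rewrite /exp_coeff /=; ring.
rewrite [leRHS]mulrAC ler_wpM2l//.
  by rewrite mulr_ge0 ?mx_l1_ge0// exprn_ge0 ?normc_ge0.
apply: (@le_trans _ _ (series (exp_coeff x) k.+2)).
  rewrite /series /= big_mkord 2!big_ord_recl /= addrA lerDr addr_ge0//;
    by rewrite exp_coeff_ge0 ?mx_l1_ge0.
apply: nondecreasing_cvgn_le; last exact: is_cvg_series_exp_coeff.
by apply: nondecreasing_series => i _ _; rewrite exp_coeff_ge0 ?mx_l1_ge0.
Qed.

End Sandwich.
Arguments cvg_exp_sandwich {R m n} A X B.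

(** * The flow of the coordinates *)

Section Flow.
Variable R : realType.
Local Notation C := R[i].
Local Notation "u ~~> l" := (u @ \oo --> (l : 'M[C^o]_(_, _))) (at level 70).

(** A quadratic error bound on the unit disc is all that is needed of the
    exponential to compute its complex derivative. *)
Lemma is_derive_quadratic (f : C -> C) (z df : C) (c : R) : 0 <= c ->
  (forall h, normc h <= 1 ->
    normc (f (h + z) - f z - h * df) <= c * normc h ^+ 2) ->
  is_derive (z : C^o) 1 (f : C^o -> C^o) df.
Proof.
move=> c0 fh.
suff q : (fun h : C^o => h^-1 *: (((f : C^o -> C^o) \o shift z) (h *: 1) - f z))
    @ (0 : C^o)^' --> (df : C^o).
  split; first exact: (cvgP _ q).
  by apply: cvg_lim q; exact: norm_hausdorff.
apply/(@cvgrPdist_lt _ C^o) => e e0.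
have [eIm eRe] : complex.Im e = 0 /\ 0 < complex.Re e.
  by move: e0; rewrite ltcE /= => /andP[/eqP -> ->].
have -> : e = (complex.Re e)%:C by apply/eqP; rewrite eq_complex /= eIm !eqxx.
set r := complex.Re e in eRe *.
(* The difference quotient is within [c |h|] of [df]; [c + 1] avoids a zero
   denominator. *)
pose d := Num.min 1 (r / (c + 1)).
have c1 : 0 < c + 1 by rewrite ltr_wpDl.
have d0 : 0 < d by rewrite lt_min ltr01 divr_gt0.
near=> h.
have hd : normc h < d.
  suff : `|h| < d%:C :> C by rewrite -[X in X < _]/((normc h)%:C) ltcR.
  by near: h; apply: (@dnbhs0_lt _ C^o); rewrite (ltcR 0).
have h0 : h != 0 by near: h; exact: nbhs_dnbhs_neq.
have hn0 : 0 < normc h.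
  rewrite lt_neqAle normc_ge0 andbT eq_sym.
  by apply: contra_neq h0; exact: eq0_normc.
rewrite -[X in X < _]/((normc _)%:C) ltcR.
rewrite -normcN opprB /= -[h *: 1]/(h * 1) mulr1.
have -> : h^-1 *: (f (h + z) - f z) - df = h^-1 * (f (h + z) - f z - h * df).
  by rewrite -[h^-1 *: _]/(h^-1 * _) [RHS]mulrBr mulKf.
rewrite normcM normcV.
move: hd; rewrite lt_min => /andP[/ltW h1 hr].
rewrite mulrC ltr_pdivrMr//; apply: le_lt_trans (fh _ h1) _.
rewrite expr2 mulrA ltr_pM2r//.
by move: hr; rewrite ltr_pdivlMr// => hr; nra.
Unshelve. all: by end_near. Qed.

Section Coordinates.
Variables (n d : nat) (S : 'I_d -> 'M[C]_n).
Hypothesis Sbasis : orthonormal_basis S.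

Lemma coords_sum_free (c : 'I_d -> C) b :
  coords S (\sum_(a < d) c a *: S a) b ord0 = c b.
Proof.
rewrite mxE mulmx_suml raddf_sum (bigD1 b)//= big1 => [|a ab].
  by rewrite -scalemxAl linearZ /= Sbasis.2 eqxx mulr1 addr0.
by rewrite -scalemxAl linearZ /= Sbasis.2 (negbTE ab) mulr0.
Qed.

Lemma traceless_sym_expansion (X : 'M[C]_n) : X \in traceless_sym R n ->
  X = \sum_(a < d) coords S X a ord0 *: S a.
Proof.
move=> XV; have XS : X \in <<[tuple S a | a < d]>>%VS.
  rewrite /= -[[seq _ | _ <- _]]/(codom S).
  by rewrite (span_basis Sbasis.1).
suff [c Xc] : exists c : 'I_d -> C, X = \sum_(a < d) c a *: S a.
  by rewrite {1}Xc; apply: eq_bigr => a _; rewrite Xc coords_sum_free.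
exists (fun a => coord [tuple S a | a < d] a X).
rewrite {1}(coord_span XS); apply: eq_bigr => a _.
by rewrite -tnth_nth tnth_mktuple.
Qed.

Lemma basis_sym_traceless a : (S a)^T = S a /\ \tr (S a) = 0.
Proof.
apply/traceless_symP; apply: (basis_mem Sbasis.1); exact: codom_f.
Qed.

Hypothesis n_gt0 : (0 < n)%N.

(** Subtracting the scalar matrix with the same trace gives a traceless
    symmetric matrix, with the same coordinates because the basis is traceless. *)
Lemma sym_expansion (X : 'M[C]_n) : X^T = X ->
  X = (\tr X / n%:R)%:M + \sum_(a < d) coords S X a ord0 *: S a.
Proof.
move=> Xsym; pose Y := X - (\tr X / n%:R)%:M.
have n0 : (n%:R : C) != 0 by rewrite pnatr_eq0 -lt0n.
have YV : Y \in traceless_sym R n.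
  apply/traceless_symP; split; first by rewrite linearB /= Xsym tr_scalar_mx.
  by rewrite linearB /= mxtrace_scalar -[_ *+ n]mulr_natr divfK// subrr.
have YX a : coords S Y a ord0 = coords S X a ord0.
  rewrite !mxE mulmxBl linearB /= mul_scalar_mx linearZ /=.
  by rewrite (basis_sym_traceless a).2 mulr0 subr0.
under eq_bigr do rewrite -YX.
by rewrite -traceless_sym_expansion// addrC subrK.
Qed.

Section SkewFlow.
Variable K : 'M[C]_n.
Hypothesis K_skew : K^T = - K.

(** The scalar part of [X] commutes with [K], so only the expansion of [X] on the
    basis contributes. *)
Lemma coords_commutator (X : 'M[C]_n) : X^T = X ->
  coords S (mxcommutator K X) = flow_gen S K *m coords S X.
Proof.
move=> Xsym; apply/colP => a; rewrite !mxE.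
have -> : mxcommutator K X =
    \sum_(b < d) coords S X b ord0 *: mxcommutator K (S b).
  rewrite {1}(sym_expansion Xsym) /mxcommutator mulmxDl mulmxDr opprD addrACA.
  rewrite scalar_mxC subrr add0r mulmx_sumr mulmx_suml -sumrB.
  by apply: eq_bigr => b _; rewrite -scalemxAr -scalemxAl scalerBr.
rewrite mulmx_suml raddf_sum; apply: eq_bigr => b _.
by rewrite -scalemxAl /= mxtraceZ [in RHS]mxE mulrC mxtrace_mulC.
Qed.

Lemma sylvester_skew z (X : 'M[C]_n) :
  sylvester (z *: K) (z *: K)^T X = z *: mxcommutator K X.
Proof.
rewrite /sylvester linearZ /= K_skew scalerN mulmxN -scalemxAl -scalemxAr.
by rewrite -scalerBr.
Qed.

Lemma iter_sylvester_sym z k (X : 'M[C]_n) : X^T = X ->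
  (iter k (sylvester (z *: K) (z *: K)^T) X)^T =
  iter k (sylvester (z *: K) (z *: K)^T) X.
Proof.
move=> Xsym; elim: k => // k IHk; rewrite iterS {1}/sylvester linearD /=.
by rewrite !trmx_mul trmxK IHk addrC.
Qed.

(** The iterates stay symmetric, which allows [coords_commutator] to be applied
    at each step. *)
Lemma coords_iter_sylvester z k (X : 'M[C]_n) : X^T = X ->
  coords S (iter k (sylvester (z *: K) (z *: K)^T) X) =
  (z *: flow_gen S K) ^+ k *m coords S X.
Proof.
move=> Xsym; elim: k => [|k IHk]; first by rewrite expr0 mul1mx.
rewrite iterS sylvester_skew exprS -mulmxE -mulmxA -IHk -scalemxAl.
rewrite -coords_commutator; last exact: iter_sylvester_sym.
by apply/colP => a; rewrite !mxE -scalemxAl linearZ.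
Qed.

Lemma cvg_coords (u : nat -> 'M[C]_n) l :
  u ~~> l -> (fun k => coords S (u k)) ~~> coords S l.
Proof.
move=> ul; apply: cvg_entries => a j; rewrite mxE.
under eq_fun do rewrite mxE.
apply: (@cvgn_sum _ C^o) => i; apply: cvg_entry.
have SS : (fun _ : nat => S a) ~~> S a by exact: (@cvg_cst 'M[C^o]_n).
exact: cvg_mulmx ul SS.
Qed.

(** Both sides are sums of series with equal terms: the left one by
    [cvg_exp_sandwich], the right one by definition of the exponential. *)
Lemma coords_congruence z (X : 'M[C]_n) : X^T = X ->
  coords S (expmx (z *: K) *m X *m (expmx (z *: K))^T) =
  expmx (z *: flow_gen S K) *m coords S X.
Proof.
move=> Xsym; rewrite expmx_tr.
have L := cvg_coords (cvg_exp_sandwich (z *: K) X (z *: K)^T).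
apply: (cvg_mx_unique L).
have XX : (fun _ : nat => coords S X) ~~> coords S X.
  exact: (@cvg_cst 'M[C^o]_(d, 1)).
have := cvg_mulmx (cvg_expmx (z *: flow_gen S K)) XX.
apply: cvg_trans; apply: near_eq_cvg; near=> k.
rewrite /series /= mulmx_suml; apply/colP => a; rewrite summxE mxE.
rewrite mulmx_suml raddf_sum; apply: eq_bigr => i _.
by rewrite -!scalemxAl /= mxtraceZ -coords_iter_sylvester// !mxE.
Unshelve. all: by end_near. Qed.

(** By cyclicity of the trace, the entry at [(a, b)] is
    [tr (S b S a K) - tr (S a S b K)], which changes sign when [a] and [b] are
    exchanged. *)
Lemma flow_gen_skew : (flow_gen S K)^T = - flow_gen S K.
Proof.
apply/matrixP => a b; rewrite !mxE /mxcommutator !mulmxBr.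
have trB (Y Z : 'M[C]_n) : \tr (Y - Z) = \tr Y - \tr Z by rewrite linearB.
rewrite [LHS]trB [in RHS]trB opprB.
congr (_ - _); first by rewrite mulmxA mxtrace_mulC.
by rewrite mxtrace_mulC mulmxA.
Qed.

End SkewFlow.
End Coordinates.

Lemma skew_flow_orthogonal d (W : 'M[C]_d) z : W^T = - W ->
  complex_orthogonal (expmx (z *: W)).
Proof.
by move=> Wsk; rewrite /complex_orthogonal expmx_tr linearZ /= Wsk scalerN expmxN.
Qed.

Lemma expmx_scaleD d (W : 'M[C]_d) h z :
  expmx ((h + z) *: W) = expmx (h *: W) *m expmx (z *: W).
Proof.
rewrite scalerDl expmxD//.
by rewrite linearZ /= [RHS]linearZ /= -!scalemxAl !scalerA mulrC.
Qed.

(** Since [exp ((h + z) W) v = exp (h W) (exp (z W) v)], the quadratic bound at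
    [0] transfers to every [z]. *)
Lemma is_derive_exp_flow d (W : 'M[C]_d) (v : 'cV[C]_d) z a :
  is_derive (z : C^o) 1
    ((fun w => (expmx (w *: W) *m v) a ord0) : C^o -> C^o)
    (\sum_(b < d) W a b * (expmx (z *: W) *m v) b ord0).
Proof.
have step (E : 'M[C]_d) (V V' : 'cV[C]_d) h : V' = E *m V ->
    normc (V' a ord0 - V a ord0 - h * \sum_(b < d) W a b * V b ord0) <=
    mx_l1 (E - (1%:M + h *: W)) * mx_l1 V.
  move=> ->; have -> : \sum_(b < d) W a b * V b ord0 = (W *m V) a ord0.
    by rewrite [RHS]mxE.
  have -> : (E *m V) a ord0 - V a ord0 - h * (W *m V) a ord0 =
      ((E - (1%:M + h *: W)) *m V) a ord0.
    rewrite mulmxBl mulmxDl mul1mx -scalemxAl.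
    rewrite [RHS]mxE [X in _ = _ + X]mxE [X in _ = _ - X]mxE.
    by rewrite [X in _ = _ - (_ + X)]mxE opprD addrA.
  by apply: le_trans (normc_le_mx_l1 _ _ _) (mx_l1M _ _).
apply: (@is_derive_quadratic _ _ _
  (mx_l1 (1%:M : 'M[C]_d) * expR (mx_l1 W) * mx_l1 (expmx (z *: W) *m v))).
  by rewrite !mulr_ge0 ?mx_l1_ge0 ?expR_ge0.
move=> h h1; apply: le_trans (step (expmx (h *: W)) _ _ _ _) _.
  by rewrite expmx_scaleD mulmxA.
rewrite [leRHS]mulrAC; apply: ler_wpM2r; first exact: mx_l1_ge0.
exact: mx_l1_exp_taylor.
Qed.

Lemma Dmx_unit M (nu : 'cV[R]_M) :
  (forall i, 0 < nu i ord0) -> Dmx nu \in unitmx.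
Proof.
move=> nu0; rewrite unitmxE det_diag unitfE; apply/prodf_neq0 => i _.
by rewrite mxE sqrtr_eq0 -ltNge.
Qed.

(** Detailed balance says that [D^2 P] is symmetric, and [Amx] is [D^2 P]
    multiplied on both sides by the inverse of [D]. *)
Lemma Amx_sym M (Q : 'M[R]_M) (nu : 'cV[R]_M) (Lam : R) :
  (forall i, 0 < nu i ord0) -> detailed_balance Q nu ->
  (Amx Q nu Lam)^T = Amx Q nu Lam.
Proof.
move=> nu0 rev; have Du := Dmx_unit nu0; rewrite /Amx.
set P := uniformized Q Lam; set D := Dmx nu in Du *.
have DT : D^T = D by rewrite tr_diag_mx.
have DDP : D *m D *m P = P^T *m (D *m D).
  apply/matrixP => i j.
  rewrite mulmx_diag mul_diag_mx mul_mx_diag !mxE -!expr2.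
  rewrite !sqr_sqrtr ?ltW// eq_sym; case: eqVneq => [->|_]; first by rewrite mulrC.
  by rewrite !add0r mulrCA rev mulrCA mulrC.
rewrite !trmx_mul trmx_inv DT.
apply: (can_inj (mulmxK Du)); apply: (can_inj (mulKmx Du)).
by rewrite [LHS]mulmxA mulKVmx// [RHS]mulmxA mulmxA mulmxKV// mulmxA DDP mulmxA.
Qed.

Lemma Kmx_skew M (Q : 'M[R]_M) (nu : 'cV[R]_M) (Lam : R) :
  (Amx Q nu Lam)^T = Amx Q nu Lam -> (Kmx Q nu Lam)^T = - Kmx Q nu Lam.
Proof.
move=> Asym; rewrite /Kmx tr_block_mx opp_block_mx !trmx0 !oppr0 !linearZ /=.
have -> : (cplx_mx (Amx Q nu Lam))^T = cplx_mx (Amx Q nu Lam).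
  have AE i j : Amx Q nu Lam i j = Amx Q nu Lam j i.
    by rewrite -[in LHS]Asym [LHS]mxE.
  by apply/matrixP => i j; rewrite [LHS]mxE [LHS]mxE [RHS]mxE AE.
by rewrite !scaleNr !scalerN opprK.
Qed.

End Flow.

(** * An orthonormal basis of the traceless symmetric matrices *)

Section Basis.
Variables (R : realType) (n' : nat).
Local Notation C := R[i].
Local Notation n := n'.+2.

Variables (s t : C).
Hypothesis s_sqr : s ^+ 2 = n%:R.
Hypothesis t_sqr : t ^+ 2 = 2.

(** With [s^2 = n] and [t^2 = 2].  The diagonal elements are the images of
    [e_i], [i != 0], under the reflection exchanging [e_0] and
    [(1, ..., 1) / s], namely [e_i + (e_0 - (1, ..., 1) / s) / (s - 1)]; unlike
    the usual triangular choice they are all given by one formula. *)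
Definition sym_unit (p : 'I_n * 'I_n) : 'M[C]_n :=
  if p.1 == p.2
  then delta_mx p.1 p.1 + (s - 1)^-1 *: delta_mx 0 0 - ((s - 1)^-1 / s)%:M
  else t^-1 *: (delta_mx p.1 p.2 + delta_mx p.2 p.1).

Definition upper_index : {set 'I_n * 'I_n} :=
  [set p : 'I_n * 'I_n | (p.1 <= p.2)%N]%SET :\ (0, 0).

(** Counted by columns, the pairs [i <= j] number [1 + 2 + ... + n]. *)
Lemma card_upper_index : #|upper_index| = traceless_sym_dim n.
Proof.
have := cardsD1 ((0, 0) : 'I_n * 'I_n) [set p : 'I_n * 'I_n | (p.1 <= p.2)%N]%SET.
rewrite inE /= add1n -/upper_index.
suff -> : #|[set p : 'I_n * 'I_n | (p.1 <= p.2)%N]%SET| = (n * n.+1 %/ 2)%N.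
  by rewrite /traceless_sym_dim => ->; rewrite subn1.
rewrite divn2 [(n * _)%N]mulnC -[X in (_ * X)./2]/(n.+1.-1) -bin2 -bin2_sum.
rewrite big_nat_recl// add0n big_mkord -sum1_card.
rewrite (eq_bigl (fun p : 'I_n * 'I_n => true && (p.1 <= p.2)%N)); last first.
  by move=> p; rewrite inE.
rewrite -(pair_big_dep xpredT (fun i j : 'I_n => i <= j)%N (fun _ _ => 1%N)) /=.
rewrite (exchange_big_dep xpredT) //=; apply: eq_bigr => j _.
by rewrite -(big_ord_widen n (fun=> 1%N) (ltn_ord j)) sum_nat_const card_ord muln1.
Qed.

Lemma tr_delta m (i j : 'I_m) : \tr (delta_mx i j : 'M[C]_m) = (i == j)%:R.
Proof.
rewrite /mxtrace (bigD1 i)//= big1 ?addr0 => [|l li]; first by rewrite mxE eqxx.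
by rewrite mxE (negbTE li).
Qed.

Lemma tr_deltaM m (i j l r : 'I_m) :
  \tr (delta_mx i j *m delta_mx l r : 'M[C]_m) = (j == l)%:R * (i == r)%:R.
Proof.
by rewrite mul_delta_mx_cond; case: eqP => _; rewrite ?mulr1n ?mulr0n
  ?mul1r ?mul0r ?tr_delta ?mxtrace0.
Qed.

Lemma s_neq0 : s != 0.
Proof. by rewrite -sqrf_eq0 s_sqr pnatr_eq0. Qed.

Lemma sB1_neq0 : s - 1 != 0.
Proof.
rewrite subr_eq0; apply/eqP => s1; have := s_sqr.
by rewrite s1 expr1n => /eqP; rewrite (eqr_nat C 1 n).
Qed.

Lemma t_neq0 : t != 0.
Proof. by rewrite -sqrf_eq0 t_sqr pnatr_eq0. Qed.

Lemma sym_unit_traceless_sym p : sym_unit p \in traceless_sym R n.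
Proof.
apply/traceless_symP; rewrite /sym_unit.
case: p => i j /=; case: eqVneq => ij; split.
- by rewrite linearB linearD /= linearZ /= !trmx_delta tr_scalar_mx.
- rewrite linearB linearD /= linearZ /= !tr_delta !eqxx mxtrace_scalar.
  rewrite -[_ *+ n]mulr_natr -s_sqr; have := s_neq0; have := sB1_neq0.
  by move=> h1 h2 /=; field; rewrite h1 h2.
- by rewrite linearZ /= linearD /= !trmx_delta addrC.
- by rewrite linearZ /= linearD /= !tr_delta [j == i]eq_sym (negbTE ij) addr0 mulr0.
Qed.

Lemma trM_shift m (a c : C) (X1 X2 Y : 'M[C]_m) :
  \tr ((X1 + a *: X2 - c%:M) *m Y) =
  \tr (X1 *m Y) + a * \tr (X2 *m Y) - c * \tr Y.
Proof.
rewrite mulmxBl mulmxDl -scalemxAl mul_scalar_mx.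
by rewrite [LHS]linearB [X in X - _]linearD /= [X in _ + X - _]linearZ linearZ.
Qed.

Lemma trM_pair m (a : C) (X1 X2 Y : 'M[C]_m) :
  \tr (a *: (X1 + X2) *m Y) = a * (\tr (X1 *m Y) + \tr (X2 *m Y)).
Proof. by rewrite -scalemxAl mulmxDl [LHS]linearZ linearD. Qed.

Lemma sym_unit_orthonormal p q : p \in upper_index -> q \in upper_index ->
  \tr (sym_unit p *m sym_unit q) = (p == q)%:R.
Proof.
have diagC i j (Y : 'M[C]_n) : \tr (delta_mx i j *m Y) = \tr (Y *m delta_mx i j).
  exact: mxtrace_mulC.
have off0 (x y w : 'I_n) : x != y -> (y == w)%:R * (x == w)%:R = 0 :> C.
  by move=> xy; case: eqVneq => [<-|_]; rewrite ?(negbTE xy) ?mulr0 ?mul0r.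
move=> pI qI; have /traceless_symP[_ q0] := sym_unit_traceless_sym q.
move: pI qI q0; rewrite /sym_unit; case: p q => [i j] [l r].
rewrite !inE !xpair_eqE /= => /andP[ij0 ij] /andP[lr0 lr] trq.
have s0 := s_neq0; have s1 := sB1_neq0; have t0 := t_neq0.
have [ijE|ij_neq] := eqVneq i j.
  subst j; move: ij0; rewrite andbb => /negbTE i0.
  rewrite trM_shift trq mulr0 subr0 !diagC.
  have [lrE|lr_neq] := eqVneq l r.
    subst r; move: lr0; rewrite andbb => /negbTE l0.
    rewrite !trM_shift !tr_deltaM !tr_delta !eqxx [0 == i]eq_sym i0 l0.
    by rewrite [l == i]eq_sym; case: eqVneq => /= _; field; rewrite s0 s1.
  rewrite !trM_pair !tr_deltaM ![(l == _)%:R * _]mulrC !(off0 _ _ _ lr_neq).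
  rewrite addr0 !mulr0 addr0.
  by case: eqVneq => [->|//]; rewrite (negbTE lr_neq).
rewrite trM_pair !diagC.
have [lrE|lr_neq] := eqVneq l r.
  subst r; rewrite !trM_shift !tr_deltaM !tr_delta ![l == _]eq_sym.
  rewrite ![0 == _]eq_sym [j == i]eq_sym (negbTE ij_neq).
  rewrite ![(i == _)%:R * _]mulrC ?off0 //.
  rewrite !(mulr0, addr0, subr0).
  by case: eqVneq => [il|//]; rewrite -il eq_sym (negbTE ij_neq).
rewrite !trM_pair !tr_deltaM.
have ltij : (i < j)%N by rewrite ltn_neqAle ij_neq.
have ltlr : (l < r)%N by rewrite ltn_neqAle lr_neq.
have z : (r == i) && (l == j) = false.
  by apply/negP => /andP[/eqP ri /eqP lj]; subst; rewrite ltnNge ltnW in ltij.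
rewrite -!natrM !mulnb z [(l == j) && _]andbC z.
rewrite [(l == i) && _]andbC ![_ == i]eq_sym.
rewrite [r == j]eq_sym [(j == r) && _]andbC.
case: (_ && _); rewrite !(addr0, add0r, mulr0)//= -mulrDr mulrA -invfM -expr2.
by rewrite t_sqr mulVf // pnatr_eq0.
Qed.

Definition upper_pair (a : 'I_(traceless_sym_dim n)) : 'I_n * 'I_n :=
  enum_val (cast_ord (esym card_upper_index) a).

Lemma upper_pair_surj p : p \in upper_index -> exists a, upper_pair a = p.
Proof.
move=> pI; exists (cast_ord card_upper_index (enum_rank_in pI p)).
by rewrite /upper_pair cast_ordK enum_rankK_in.
Qed.

Definition upper_entries (Y : 'M[C]_n) : 'rV[C]_(traceless_sym_dim n) :=
  \row_a Y (upper_pair a).1 (upper_pair a).2.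

Lemma upper_entries_is_linear : linear upper_entries.
Proof. by move=> c Y Z; apply/rowP => a; rewrite !mxE. Qed.

HB.instance Definition _ := GRing.isLinear.Build C 'M[C]_n
  'rV[C]_(traceless_sym_dim n) _ upper_entries upper_entries_is_linear.

(** Symmetry determines all entries but the one at [(0, 0)], which the trace
    condition then determines. *)
Lemma upper_entries_inj Y :
  Y \in traceless_sym R n -> upper_entries Y = 0 -> Y = 0.
Proof.
move=> /traceless_symP[Ysym Ytr] Y0.
have Yup (i j : 'I_n) : (i <= j)%N -> (i, j) != (0, 0) -> Y i j = 0.
  move=> ij ij0; have [|a ea] := @upper_pair_surj (i, j).
    by rewrite !inE ij0.
  by have /rowP/(_ a) := Y0; rewrite !mxE ea.
have Yoff (i j : 'I_n) : (i, j) != (0, 0) -> Y i j = 0.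
  move=> ij0; have [ij|/ltnW ji] := leqP i j; first exact: Yup.
  rewrite -Ysym mxE Yup//; apply: contra_neq ij0.
  by move=> [-> ->].
have Y00 : Y 0 0 = 0.
  rewrite -Ytr /mxtrace (bigD1 0)//= big1 ?addr0// => i i0; rewrite Yoff//.
  by rewrite xpair_eqE negb_and i0.
apply/matrixP => i j; rewrite mxE.
by have [[-> ->]//|ij0] := eqVneq (i, j) (0, 0); exact: Yoff.
Qed.

Lemma dim_traceless_sym_le : (\dim (traceless_sym R n) <= traceless_sym_dim n)%N.
Proof.
have <- : \dim (linfun upper_entries @: traceless_sym R n) =
    \dim (traceless_sym R n).
  apply/limg_dim_eq/eqP; rewrite -subv0; apply/subvP => Y.
  rewrite memv_cap memv_ker lfunE /= => /andP[YV /eqP Y0].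
  by rewrite (upper_entries_inj YV Y0) mem0v.
apply: leq_trans (dimvS (subvf _)) _; rewrite dimvf dim_matrix.
by apply: eq_leq; exact: mul1n.
Qed.

(** Orthonormality gives freeness, and [dim_traceless_sym_le] bounds the
    dimension by the number of elements. *)
Lemma orthonormal_basis_sym_unit :
  orthonormal_basis (fun a : 'I_(traceless_sym_dim n) => sym_unit (upper_pair a)).
Proof.
have upI a : upper_pair a \in upper_index by exact: enum_valP.
have up_inj : injective upper_pair by move=> a b /enum_val_inj/cast_ord_inj.
pose S a := sym_unit (upper_pair a); rewrite -/S.
have SS a b : \tr (S a *m S b) = (a == b)%:R.
  by rewrite sym_unit_orthonormal// (inj_eq up_inj).
split=> //; set X := [tuple S a | a < _].
have Xa (a : 'I_(traceless_sym_dim n)) : X`_a = S a.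
  by rewrite -tnth_nth tnth_mktuple.
rewrite -[codom S]/(X : seq _) basisEfree size_tuple; apply/and3P; split.
- apply/freeP => c c0 b.
  have cS : \sum_a c a *: S a = 0.
    by rewrite -[RHS]c0; apply: eq_bigr => a _; rewrite Xa.
  have := congr1 (fun Y => \tr (Y *m S b)) cS.
  rewrite mulmx_suml mul0mx mxtrace0 raddf_sum (bigD1 b)//= big1 => [|a ab].
    by rewrite -scalemxAl mxtraceZ SS eqxx mulr1 addr0.
  by rewrite -scalemxAl mxtraceZ SS (negbTE ab) mulr0.
- by apply/span_subvP => Y /codomP[a ->]; exact: sym_unit_traceless_sym.
- exact: dim_traceless_sym_le.
Qed.

End Basis.

Lemma exists_orthonormal_basis (R : realType) n : (1 < n)%N ->
  exists S : 'I_(traceless_sym_dim n) -> 'M[R[i]]_n, orthonormal_basis S.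
Proof.
case: n => [//|[//|n]] _.
exists (fun a => sym_unit (sqrtc n.+2%:R) (sqrtc 2) (upper_pair a)).
exact: orthonormal_basis_sym_unit (sqr_sqrtc _) (sqr_sqrtc _).
Qed.

(** * The coordinate flow of the pseudo-density *)

Lemma orthogonal_sum_sqr (R : realType) d (P : 'M[R[i]]_d) (v : 'cV[R[i]]_d) :
  complex_orthogonal P ->
  \sum_(a < d) (P *m v) a ord0 ^+ 2 = \sum_(a < d) v a ord0 ^+ 2.
Proof.
have sumsqE (w : 'cV[R[i]]_d) :
    \sum_(a < d) w a ord0 ^+ 2 = (w^T *m w) ord0 ord0.
  by rewrite mxE; apply: eq_bigr => a _; rewrite mxE expr2.
move=> Porth; rewrite (sumsqE v) (sumsqE (P *m v)) trmx_mul.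
by rewrite -mulmxA [P^T *m _]mulmxA Porth mul1mx.
Qed.

Theorem proposition5p5 (R : realType) (M : nat) (Q : 'M[R]_M) (nu : 'cV[R]_M)
    (Lam : R) (pi0 : 'cV[R]_M)
    (M_ge2 : (2 <= M)%N)
    (Q_gen : is_generator Q)
    (Q_irr : irreducible_generator Q)
    (nu_stat : is_stationary_law Q nu)
    (Q_rev : detailed_balance Q nu)
    (Lam_gt0 : 0 < Lam)
    (Lam_ge : forall i, - Q i i <= Lam)
    (pi0_law : is_law pi0) :
  let N := (M + M)%N in
  let d := traceless_sym_dim N in
  (exists S : 'I_d -> 'M[R[i]]_N, orthonormal_basis S) /\
  forall S : 'I_d -> 'M[R[i]]_N, orthonormal_basis S ->
  let rho := pseudo_density Q nu Lam pi0 in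
  let r := fun z : R[i] => coords S (rho z) in
  let Omega := flow_gen S (Kmx Q nu Lam) in
  [/\ forall z : R[i],
        rho z = (\tr (rho z) / N%:R)%:M + \sum_(a < d) r z a ord0 *: S a,
      forall (z : R[i]) (a : 'I_d),
        is_derive (z : R[i]^o) 1 ((fun w => r w a ord0) : R[i]^o -> R[i]^o)
          (\sum_(b < d) Omega a b * r z b ord0),
      Omega^T = - Omega,
      forall z : R[i], complex_orthogonal (expmx (z *: Omega)) /\
        r z = expmx (z *: Omega) *m r 0
    & forall z : R[i],
        \sum_(a < d) r z a ord0 ^+ 2 = \sum_(a < d) r 0 a ord0 ^+ 2].

Proof.
move=> N d.
have N_gt1 : (1 < N)%N by rewrite /N (leq_trans M_ge2) ?leq_addr.
split=> [|S Sbasis rho r Omega]; first exact: exists_orthonormal_basis.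
have N_gt0 : (0 < N)%N := ltnW N_gt1.
have [_ nu_gt0 _] := nu_stat.
have K_skew : (Kmx Q nu Lam)^T = - Kmx Q nu Lam.
  exact/Kmx_skew/Amx_sym.
pose Phi0 := Bmx nu *m col_mx (cplx_mx pi0) 0.
pose rho0 := Phi0 *m Phi0^T.
have rho0_sym : rho0^T = rho0 by rewrite trmx_mul trmxK.
have rhoE z : rho z = expmx (z *: Kmx Q nu Lam) *m rho0
                        *m (expmx (z *: Kmx Q nu Lam))^T.
  by rewrite /rho /pseudo_density /pseudo_wave trmx_mul -/Phi0 !mulmxA.
have rE0 z : r z = expmx (z *: Omega) *m coords S rho0.
  by rewrite /r rhoE coords_congruence.
have r0 : r 0 = coords S rho0 by rewrite rE0 scale0r expmx0 mul1mx.
have rE z : r z = expmx (z *: Omega) *m r 0 by rewrite r0 rE0.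
have Omega_skew : Omega^T = - Omega by exact: flow_gen_skew.
split.
- move=> z; apply: sym_expansion => //.
  by rewrite rhoE [LHS]trmx_mul trmxK [X in _ *m X]trmx_mul rho0_sym mulmxA.
- move=> z a.
  have -> : (fun w => r w a ord0) = fun w => (expmx (w *: Omega) *m r 0) a ord0.
    by apply/funext => w; rewrite -rE.
  under eq_bigr do rewrite rE.
  exact: is_derive_exp_flow.
- exact: Omega_skew.
- by move=> z; split; [exact: skew_flow_orthogonal | exact: rE].
- move=> z; have := orthogonal_sum_sqr (r 0) (skew_flow_orthogonal z Omega_skew).
  by rewrite -rE.
Qed.
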